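(* Let $p_0,p_1,\sigma$ be positive real scalars. Consider the scalar optimization problem $$\min_{p_t,a_t}\left\{\int_0^1 p_t^{-1}a_tp_ta_t\,dt=\int_0^1 a_t^2\,dt\;\middle|\;\dot p_t=2a_tp_t+\sigma^2\text{ on }[0,1],\ p_t|_{t=0}=p_0,\ p_t|_{t=1}=p_1\right\}.$$ (i) If $|p_1-p_0|>\sigma^2$, then there exists a unique solution to this problem, and its covariance path has the form $$p_t=\alpha e^{bt}-\frac{\sigma^4}{4\alpha b^2}e^{-bt}$$ for some nonzero real constants $\alpha,b$. (ii) If $|p_1-p_0|<\sigma^2$, then there exists a unique solution to this problem, and its covariance path has the form $$p_t=\frac{\sigma^2}{\omega}\cos(\omega t+\theta)$$ for some constants $0<\omega<\pi$ and $-\tfrac{\pi}{2}<\theta<\tfrac{\pi}{2}$.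
   Context: The problem is the scalar ($n=1$) case of minimizing $\int_0^1\operatorname{tr}(P_t^{-1}A_tP_tA_t')\,dt$ subject to $\dot P_t=A_tP_t+P_tA_t'+\sigma^2 I$ with the endpoints $P_0,P_1$ specified. The minimization is over pairs of real-valued functions $(p_t,a_t)$ on $[0,1]$ with $p_t>0$ for all $t\in[0,1]$. *)

(* Defs.v *)
From mathcomp Require Import all_boot all_order all_algebra.
From mathcomp Require Import all_classical all_reals all_analysis.

Set Implicit Arguments.
Unset Strict Implicit.
Unset Printing Implicit Defensive.

Import Order.TTheory GRing.Theory Num.Theory.
Import numFieldNormedType.Exports.

Local Open Scope classical_set_scope.
Local Open Scope ring_scope.

(* Functions on [0, 1] are total functions R -> R; no definition below depends
   on their values outside [0, 1]. *)

(* Derivative relative to [0, 1]: two-sided at interior points, one-sided at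
   0 and at 1. *)
Definition is_derive01 (R : realType) (f : R -> R) (t l : R) : Prop :=
  (fun s => (f s - f t) / (s - t)) @ within `[0, 1] t^' --> l.

(* No regularity is imposed beyond the differential equation holding at every
   point of [0, 1]; in particular p is only required to be differentiable, and
   a = (p' - sigma^2) / (2 p) is then automatically measurable on [0, 1]. *)
Definition feasible (R : realType) (sigma p0 p1 : R) (p a : R -> R) : Prop :=
  [/\ forall t : R, t \in `[0, 1] -> 0 < p t,
      forall t : R, t \in `[0, 1] ->
        is_derive01 p t (2 * a t * p t + sigma ^+ 2),
      p 0 = p0
    & p 1 = p1].

(* Lebesgue integral of a nonnegative function, with values in [0, +oo]. *)
Definition cost (R : realType) (p a : R -> R) : \bar R :=
  (\int[lebesgue_measure]_(t in `[0%R, 1%R])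
     ((p t)^-1 * a t * p t * a t)%:E)%E.

Lemma costE (R : realType) (sigma p0 p1 : R) (p a : R -> R) :
  feasible sigma p0 p1 p a ->
  cost p a = (\int[lebesgue_measure]_(t in `[0%R, 1%R]) (a t ^+ 2)%:E)%E.
Proof.
move=> [p_gt0 _ _ _]; apply: eq_integral => t; rewrite inE => t01.
have pt : p t != 0 by rewrite gt_eqF// p_gt0.
by rewrite -(mulrA _ (a t)) (mulrC (a t)) mulrA mulVf// mul1r expr2.
Qed.

Definition is_solution (R : realType) (sigma p0 p1 : R) (p a : R -> R) : Prop :=
  feasible sigma p0 p1 p a /\
  forall q c : R -> R, feasible sigma p0 p1 q c -> (cost p a <= cost q c)%E.

Definition is_unique_solution (R : realType) (sigma p0 p1 : R)
    (p a : R -> R) : Prop :=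
  is_solution sigma p0 p1 p a /\
  forall q c : R -> R, is_solution sigma p0 p1 q c ->
    forall t : R, t \in `[0, 1] -> q t = p t /\ c t = a t.

(* Main.v *)
Require Import Defs.
From mathcomp Require Import all_boot all_order all_algebra.
From mathcomp Require Import all_classical all_reals all_analysis.
From mathcomp Require Import measurable_realfun ring lra.

Set Implicit Arguments.
Unset Strict Implicit.
Unset Printing Implicit Defensive.

Import Order.TTheory GRing.Theory Num.Theory.
Import numFieldNormedType.Exports.

Local Open Scope classical_set_scope.
Local Open Scope ring_scope.

(** Put s = sigma^2 and u = ln p.  Up to a boundary term the cost
    (1/4) \int (u' - s e^-u)^2 is (1/4) \int (u'^2 + s^2 e^-2u), which is
    strictly convex in u, so a positive solution of the Euler-Lagrange equation
    u'' = - s^2 e^-2u is the unique minimizer.  For p it reads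
    p p'' - p'^2 = - s^2, i.e. p'' = K p with first integral
    K p^2 - p'^2 = - s^2.  The remaining parameter (b or omega) is found by the
    intermediate value theorem.  Since a competitor q is only differentiable,
    integrating the convexity inequality requires G(b) - G(a) <= \int h for
    every differentiable G with G' <= h, where h >= 0 is merely measurable. *)

(** * Integrating a pointwise derivative bound *)

Local Notation mu := lebesgue_measure.

(** Vitali-Caratheodory: the sum of the functions (k+1) e on the open sets U k
    is a lower semicontinuous majorant of h with almost the same integral. *)
Lemma level_cover (R : realType) (D : set R) (h : R -> R) (e : R) :
  measurable D -> (lebesgue_measure D < +oo)%E -> measurable_fun D h ->
  (forall x, D x -> 0 <= h x) -> 0 < e ->
  exists U : nat -> set R,
    [/\ forall k, open (U k),
        forall x, D x -> exists2 k, U k x & h x < k.+1%:R * e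
      & (\sum_(k <oo) (k.+1%:R * e)%:E * lebesgue_measure (U k `&` D) <=
         \int[lebesgue_measure]_(x in D) (h x)%:E
           + e%:E * lebesgue_measure D + e%:E)%E].
Proof.
move=> mD Dfin mh h0 e0.
have le_mu (A B : set R) : measurable A -> measurable B -> A `<=` B -> (mu A <= mu B)%E.
  by move=> mA mB AB; apply: le_measure; rewrite ?inE.
(* Slices of D on which h lies between k e and (k+1) e. They partition D, and outer regularity
   encloses each one in an open set. *)
pose E k := D `&` h @^-1` `[k%:R * e, k.+1%:R * e[.
have mE k : measurable (E k) by apply: mh => //; exact: measurable_itv.
have ED k : E k `<=` D by move=> x [].
have Efin k : (mu (E k) < +oo)%E.
  by apply: le_lt_trans Dfin; apply: le_mu; [exact: mE|exact: mD|exact: ED].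
(* The factor [k.+1%:R^-1] cancels the level of the slice: the excess of [U k] over [E k] then
   weighs at most e / 2^(k+1), and these weights sum to e. *)
pose eps k : R := k.+1%:R^-1 * (2 ^ k.+1)%:R^-1.
have eps_gt0 k : 0 < eps k by rewrite /eps mulr_gt0// invr_gt0 ltr0n// expn_gt0.
have /choice[U HU] : forall k, exists U : set R,
    [/\ open U, E k `<=` U & (mu (U `\` E k) < (eps k)%:E)%E].
  by move=> k; apply: lebesgue_regularity_outer; [exact: mE|exact: Efin|exact: eps_gt0].
have oU k : open (U k) by case: (HU k).
have mU k : measurable (U k) by exact: open_measurable.
have exk x : D x -> exists k, E k x.
  move=> Dx; exists (Num.trunc (h x / e)); split => //=.
  have := truncn_itv (divr_ge0 (h0 _ Dx) (ltW e0)).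
  by rewrite in_itv/= ler_pdivlMr// ltr_pdivrMr.
have DE : D = \bigcup_k E k.
  apply/seteqP; split => [x /exk[k Ekx]|x [k _ [Dx _]]]; [by exists k|exact: Dx].
have tE : trivIset setT E.
  apply/trivIsetP => i j _ _ ij; rewrite -subset0 => x [[_ +] [_ +]] /=.
  rewrite ?in_itv/= => /andP[i1 i2] /andP[j1 j2].
  move: ij; rewrite neq_lt => /orP[|] ij.
  - have : i.+1%:R * e <= j%:R * e by rewrite ler_pM2r// ler_nat.
    by move=> /(lt_le_trans i2)/lt_le_trans/(_ j1); rewrite ltxx.
  - have : j.+1%:R * e <= i%:R * e by rewrite ler_pM2r// ler_nat.
    by move=> /(lt_le_trans j2)/lt_le_trans/(_ i1); rewrite ltxx.
exists U; split => //.
  move=> x /exk[k Ekx]; exists k; first by case: (HU k) => _ + _; apply.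
  by case: Ekx => _ /=; rewrite in_itv/= => /andP[].
have mh' : measurable_fun D (fun x => (h x)%:E) by exact/measurable_EFinP.
have -> : (\int[mu]_(x in D) (h x)%:E + e%:E * mu D =
    \sum_(k <oo) \int[mu]_(x in E k) ((h x)%:E + e%:E))%E.
  rewrite -integral_cst// -ge0_integralD//; last first.
    by move=> x _; rewrite lee_fin ltW.
  rewrite {1}DE ge0_integral_bigcup//.
  - by rewrite -DE; apply: emeasurable_funD => //.
  - move=> x; rewrite -DE => Dx; rewrite adde_ge0 ?lee_fin ?h0// ltW//.
(* It remains to bound each term by the integral of h + e over [E k] plus e / 2^(k+1). *)
apply: le_trans (epsilon_trick _ _ (ltW e0)); last first.
  move=> k; apply: integral_ge0 => x [Dx _]; by rewrite adde_ge0 ?lee_fin ?h0// ltW.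
apply: lee_nneseries => [k _ _|k _].
  by rewrite mule_ge0// lee_fin mulr_ge0// ltW.
have ke0 : 0 <= k.+1%:R * e by rewrite mulr_ge0// ltW.
apply: (@le_trans _ _ ((k.+1%:R * e)%:E * (mu (E k) + (eps k)%:E))%E).
  rewrite lee_wpmul2l ?lee_fin//.
  apply: (@le_trans _ _ (mu (E k `|` (U k `\` E k)))).
    apply: le_mu.
    - by apply: measurableI; [exact: mU|exact: mD].
    - by apply: measurableU; [exact: mE|apply: measurableD; [exact: mU|exact: mE]].
    - move=> x [Ux _]; have [?|?] := pselect (E k x); [by left|by right].
  rewrite measureU//; last 3 first.
    exact: mE.
    by apply: measurableD; [exact: mU|exact: mE].
    by rewrite setDE setICA setICr setI0.
  by rewrite leeD2l// ltW//; case: (HU k).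
rewrite ge0_muleDr//; last by rewrite lee_fin ltW.
(* On [E k] the level (k+1) e is at most h + e; this accounts for the term e times the measure of
   D. *)
apply: leeD.
  rewrite -integral_cst; last exact: mE.
  apply: ge0_le_integral => //; [exact: mE| |].
  - apply: emeasurable_funD => //.
    exact: measurable_funS mh'.
  - move=> x [Dx] /=; rewrite in_itv/= => /andP[+ _].
    by rewrite lee_fin -natr1 mulrDl mul1r lerD2r.
rewrite -EFinM lee_fin /eps.
suff -> : k.+1%:R * e * (k.+1%:R^-1 * (2 ^ k.+1)%:R^-1) = e / (2 ^ k.+1)%:R :> R by [].
rewrite mulrACA divff ?mul1r//.
Qed.

(** The bound on the derivative at x only controls G infinitesimally near x, whereas h may oscillate
    there. Majorizing h by levels on open sets, as in [level_cover], gives a bound valid on a whole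
    neighbourhood of x, so a supremum argument can propagate it from a to b. *)
Lemma le_integral_derive (R : realType) (G dG h : R -> R) (a b : R) :
  a < b -> {within `[a, b], continuous G} ->
  (forall x : R, x \in `]a, b[ -> is_derive x (1 : R) G (dG x)) ->
  measurable_fun `[a, b] h -> {in `[a, b], forall x, 0 <= h x} ->
  {in `]a, b[, forall x, dG x <= h x} ->
  ((G b - G a)%:E <= \int[mu]_(x in `[a, b]) (h x)%:E)%E.
Proof.
move=> ab cG derG mh h0 dGh.
have cG' x d : x \in `[a, b] -> 0 < d -> exists2 r, 0 < r &
    forall y, y \in `[a, b] -> `|x - y| < r -> `|G x - G y| < d.
  move=> xab d0; move/subspace_continuousP : cG => /(_ x xab).
  move=> /cvgrPdist_lt/(_ _ d0); rewrite near_withinE.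
  by move=> -[r /= r0 rG]; exists r => // y yab yr; exact: rG.
apply/lee_addgt0Pr => e0 e0_gt0.
(* The errors are e (b - a) + e from [level_cover] and one more e from the slack in [T]; they add up
   to e0. *)
pose e := e0 / (b - a + 2).
have ba2 : 0 < b - a + 2 by rewrite addr_gt0// subr_gt0.
have e_gt0 : 0 < e by rewrite divr_gt0.
have muab : mu `[a, b] = (b - a)%:E by rewrite lebesgue_measure_itv/= lte_fin ab.
have [|||U [oU hU sumU]] := @level_cover R `[a, b] h e _ _ mh _ e_gt0.
- exact: measurable_itv.
- by rewrite [X in (X < _)%E]muab ltry.
- by move=> x; exact: h0.
have mU k : measurable (U k) by exact: open_measurable.
have mUI k (i : interval R) : measurable (U k `&` [set` i]).
  by apply: measurableI; [exact: mU|exact: measurable_itv].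
(* The set where G x - G a - e <= H x is closed under suprema, and from a
   point of U k it extends to the right because H grows there with slope at
   least (k+1) e > G'. *)
pose H x : \bar R := (\sum_(k <oo) (k.+1%:R * e)%:E * mu (U k `&` `[a, x]))%E.
have ke0 k : 0 <= k.+1%:R * e by rewrite mulr_ge0// ltW.
have H0 x : (0 <= H x)%E.
  by apply: nneseries_ge0 => k _ _; rewrite mule_ge0// lee_fin.
have HD x y : a <= x -> x <= y -> H y = (H x +
    \sum_(k <oo) (k.+1%:R * e)%:E * mu (U k `&` `]x, y]))%E.
  move=> ax xy; rewrite -nneseriesD; last 2 first.
  - by move=> k _ _; rewrite mule_ge0// lee_fin.
  - by move=> k _ _; rewrite mule_ge0// lee_fin.
  apply: eq_eseriesr => k _; rewrite -ge0_muleDr//; congr (_ * _)%E.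
  rewrite -measureU; [|exact: mUI|exact: mUI|].
    rewrite -setIUr; congr (mu (_ `&` _)).
    by rewrite -itv_bndbnd_setU// bnd_simp.
  rewrite setIACA setIid -subset0 => z [_ []] /=.
  by rewrite !in_itv/= => /andP[_ zx] /andP[]; rewrite ltNge zx.
have H_ge x y : a <= x -> x <= y -> (H x <= H y)%E.
  move=> ax xy; rewrite (HD _ _ ax xy) leeDl//.
  by apply: nneseries_ge0 => k _ _; rewrite mule_ge0// lee_fin.
have H_gt x y k : a <= x -> x < y -> `]x, y] `<=` U k ->
    (H x + (k.+1%:R * e * (y - x))%:E <= H y)%E.
  move=> ax xy xyU; rewrite (HD _ _ ax (ltW xy)) leeD2l//.
  apply: le_trans (nneseries_lim_ge k.+1 _); last first.
    by move=> j _ _; rewrite mule_ge0// lee_fin.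
  rewrite big_nat_recr//= (setIidr xyU).
  rewrite lebesgue_measure_itv/= lte_fin xy -EFinD -EFinM leeDr//.
  by apply: sume_ge0 => j _; rewrite mule_ge0// lee_fin.
suff Hb : ((G b - G a - e)%:E <= H b)%E.
  have := le_trans Hb sumU; rewrite muab => Gb.
  have -> : e0 = e * (b - a) + (e + e).
    by rewrite /e; field; rewrite gt_eqF.
  by move: Gb; rewrite (EFinB _ e) leeBlDr// -!addeA -EFinM -!EFinD.
pose T := [set x | x \in `[a, b] /\ ((G x - G a - e)%:E <= H x)%E].
have aab : a \in `[a, b] by rewrite in_itv/= lexx ltW.
(* The slack e absorbs the variation of G near a, which puts a point beyond a into [T]. The supremum
   is therefore greater than a, where the derivative is available unless it is b. *)
have [r r0 rG] := cG' a e aab e_gt0.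
pose x0 := a + Num.min (r / 2) (b - a).
have x0a : a < x0.
  by rewrite /x0 ltrDl lt_min divr_gt0//= subr_gt0.
have x0b : x0 <= b by rewrite /x0 -lerBrDl ge_min lexx orbT.
have Tx0 : T x0.
  split; first by rewrite in_itv/= (ltW x0a) x0b.
  apply: le_trans (H0 _); rewrite lee_fin.
  have : `|G a - G x0| < e.
    apply: rG; first by rewrite in_itv/= (ltW x0a) x0b.
    rewrite ltr0_norm ?subr_lt0// /x0 opprB addrC addKr gt_min.
    by rewrite ltr_pdivrMr// ltr_pMr// ltr1n.
  by rewrite ltr_norml => /andP[? _]; lra.
have ubT : ubound T b by move=> x [+ _]; rewrite in_itv/= => /andP[].
have supT : has_sup T by split; [exists x0|exists b].
pose c := sup T.
have x0c : x0 <= c by apply: ub_le_sup => //; exists b.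
have ac : a < c by exact: lt_le_trans x0c.
have cb : c <= b by apply: ge_sup => //; exists x0.
have cab : c \in `[a, b] by rewrite in_itv/= (ltW ac) cb.
(* [T] contains its supremum because G is continuous and [H] is nondecreasing. *)
have Tc : ((G c - G a - e)%:E <= H c)%E.
  apply/lee_addgt0Pr => d d0.
  have [q q0 qG] := cG' c d cab d0.
  have [y [yab Ty] cy] := sup_adherent q0 supT.
  have yc : y <= c by apply: ub_le_sup; [exists b|split].
  have ay : a <= y by move: yab; rewrite in_itv/= => /andP[].
  have : `|G c - G y| < d.
    apply: qG => //; rewrite ger0_norm ?subr_ge0//.
    by move: cy; rewrite -/c; lra.
  rewrite ltr_norml => /andP[_ Gcy].
  apply: (@le_trans _ _ ((G y - G a - e)%:E + d%:E)%E).
    by rewrite -EFinD lee_fin; lra.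
  by rewrite leeD2r// (le_trans Ty)// H_ge.
have [cb_eq|/eqP cNb] := c =P b; first by rewrite -cb_eq.
have {}cb : c < b by rewrite lt_neqAle cNb.
have coo : c \in `]a, b[ by rewrite in_itv/= ac cb.
have [k Ukc hck] := hU c cab.
have [q q0 qU] : exists2 q, 0 < q & forall y, `|c - y| < q -> U k y.
  by have /nbhs_ballP[q /= q0 qU] := open_nbhs_nbhs (conj (oU k) Ukc); exists q.
have [p p0 pG] : exists2 p, 0 < p & forall y, c < y -> y - c < p ->
    G y - G c <= k.+1%:R * e * (y - c).
  have [dc dcE] := derG c coo.
  have dGc : 'D_1 G c < k.+1%:R * e by rewrite dcE (le_lt_trans (dGh _ coo)).
  have : \forall z \near 0^', z^-1 *: (G (z *: 1 + c) - G c) < k.+1%:R * e.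
    by apply: cvgr_lt dGc; exact: dc.
  move=> [p /= p0 pG]; exists p => // y cy ycp.
  have yc0 : 0 < y - c by rewrite subr_gt0.
  have := pG (y - c).
  rewrite /ball_/= sub0r normrN gtr0_norm// => /(_ ycp) /=.
  rewrite gt_eqF// => /(_ isT); rewrite /GRing.scale/= mulr1 subrK.
  by rewrite ltr_pdivrMl// mulrC => /ltW.
(* A point beyond c, close enough for the slope bound on G to hold and for []c, y]] to stay inside
   [U k] and below b; it lies in [T] and contradicts the choice of c. *)
pose y := c + Num.min (Num.min p q) (b - c) / 2.
have m0 : 0 < Num.min (Num.min p q) (b - c) by rewrite !lt_min p0 q0 subr_gt0.
have [mp mq mb] : [/\ Num.min (Num.min p q) (b - c) <= p,
    Num.min (Num.min p q) (b - c) <= q & Num.min (Num.min p q) (b - c) <= b - c].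
  by rewrite !ge_min !lexx !orbT.
have yc : c < y by rewrite /y; lra.
have /(ub_le_sup (ex_intro _ b ubT)) : T y.
  split; first by rewrite in_itv/=; apply/andP; split; rewrite /y; lra.
  apply: le_trans (H_gt c y k (ltW ac) yc _); last first.
    move=> z /=; rewrite in_itv/= => /andP[cz zy]; apply: qU.
    by rewrite ltr0_norm ?subr_lt0//; move: zy; rewrite /y; lra.
  apply: le_trans (leeD Tc (lexx _)); rewrite -EFinD lee_fin.
  have ycp : y - c < p by rewrite /y; lra.
  by have := pG y yc ycp; lra.
by rewrite -/c leNgt yc.
Qed.

(** * Derivatives relative to the unit interval *)

Lemma is_derive01P (R : realType) (f : R -> R) (t l : R) :
  is_derive01 f t l <-> forall e, 0 < e -> exists2 r, 0 < r &
    forall s, s \in `[0, 1] -> s != t -> `|t - s| < r ->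
      `|l - (f s - f t) / (s - t)| < e.
Proof.
split=> [/cvgrPdist_lt fl e e0|fl].
  have := fl e e0; rewrite !near_withinE => -[r /= r0 rP].
  by exists r => // s s01 st sr; apply: rP.
apply/cvgrPdist_lt => e e0; rewrite !near_withinE.
have [r r0 rP] := fl e e0; exists r => //= s sr st s01; exact: rP.
Qed.

Lemma is_derive01_unique (R : realType) (f : R -> R) (t l1 l2 : R) :
  t \in `[0, 1] -> is_derive01 f t l1 -> is_derive01 f t l2 -> l1 = l2.
Proof.
rewrite in_itv/= => /andP[t0 t1] /is_derive01P f1 /is_derive01P f2.
apply/eqP; rewrite -subr_eq0 -normr_eq0 eq_le normr_ge0 andbT.
apply/ler_addgt0Pr => e e0; rewrite add0r.
have e20 : 0 < e / 2 by rewrite divr_gt0.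
have [r r0 rP] := f1 _ e20; have [q q0 qP] := f2 _ e20.
have [s [s01 st sr sq]] : exists s, [/\ s \in `[0, 1], s != t,
    `|t - s| < r & `|t - s| < q].
  (* The cap 1/2 keeps t + m in the interval when t <= 1/2, and t - m when t > 1/2. *)
  pose m := Num.min (Num.min (r / 2) (q / 2)) (1 / 2).
  have m0 : 0 < m by rewrite !lt_min !divr_gt0.
  have [mr mq m1] : [/\ m <= r / 2, m <= q / 2 & m <= 1 / 2].
    by rewrite !ge_min !lexx !orbT.
  have [t12|t12] := leP t (1 / 2).
    exists (t + m); rewrite in_itv/= opprD addNKr normrN gtr0_norm//.
    split; [by apply/andP; split; lra| |lra|lra].
    by rewrite -subr_eq0 addrC addKr gt_eqF.
  exists (t - m); rewrite in_itv/= opprB addrCA subrr addr0 gtr0_norm//.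
  split; [by apply/andP; split; lra| |lra|lra].
  by rewrite -subr_eq0 addrC addKr oppr_eq0 gt_eqF.
have := rP s s01 st sr; have := qP s s01 st sq.
move: (_ / _) => z; rewrite !ltr_norml => /andP[? ?] /andP[? ?].
by rewrite ler_norml; apply/andP; split; lra.
Qed.

Lemma is_derive_derive01 (R : realType) (f : R -> R) (t l : R) :
  is_derive t (1 : R) f l -> is_derive01 f t l.
Proof.
move=> [df fl]; apply/is_derive01P => e e0.
have : \forall z \near 0^', `|l - z^-1 *: (f (z *: 1 + t) - f t)| < e.
  by apply: cvgr_dist_lt e0; rewrite -fl; exact: df.
move=> [r /= r0 rP]; exists r => // s _ st sr.
have := rP (s - t); rewrite /ball_/= sub0r opprB => /(_ sr).
rewrite subr_eq0 => /(_ st).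
by rewrite /GRing.scale/= mulr1 subrK mulrC.
Qed.

Lemma derive01_is_derive (R : realType) (f : R -> R) (t l : R) :
  t \in `]0, 1[ -> is_derive01 f t l -> is_derive t (1 : R) f l.
Proof.
rewrite in_itv/= => /andP[t0 t1] /is_derive01P fl.
suff H : h^-1 *: (f (h *: 1 + t) - f t) @[h --> 0^'] --> l.
  by split; [apply/cvg_ex; exists l|exact/cvg_lim].
apply/cvgrPdist_lt => e e0; have [r r0 rP] := fl e e0.
exists (Num.min r (Num.min t (1 - t))); rewrite /= ?lt_min ?r0 ?t0 ?subr_gt0//.
move=> z /=; rewrite sub0r normrN !lt_min => /and3P[zr zt z1] z0.
have := rP (z + t); rewrite opprD addrCA subrr addr0 normrN => /(_ _ _ zr).
rewrite addrK /GRing.scale/= mulr1 mulrC; apply.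
  by move: zt z1; rewrite !ltr_norml in_itv/= => /andP[? ?] /andP[? ?];
    apply/andP; split; lra.
by rewrite -subr_eq0 addrK.
Qed.

Lemma derive01_continuous (R : realType) (f : R -> R) (d : R -> R) :
  (forall t, t \in `[0, 1] -> is_derive01 f t (d t)) ->
  {within `[0, 1], continuous f}.
Proof.
move=> fd; apply/subspace_continuousP => t t01.
apply/cvgrPdist_lt => e e0; rewrite near_withinE.
have /is_derive01P/(_ 1 ltr01)[r r0 rP] := fd t t01.
have d0 : 0 < `|d t| + 1 by rewrite ltr_wpDl.
exists (Num.min r (e / (`|d t| + 1))); first by rewrite /= lt_min r0 divr_gt0.
move=> s /=; rewrite lt_min => /andP[sr se] s01.
have [->|st] := eqVneq s t; first by rewrite subrr normr0.
have st0 : s - t != 0 by rewrite subr_eq0.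
have := rP s s01 st sr => st1.
have : `|(f s - f t) / (s - t)| <= `|d t| + 1.
  rewrite -[X in `|X|](subKr (d t)); apply: le_trans (ler_normB _ _) _.
  by rewrite lerD2l ltW.
rewrite normrM normfV ler_pdivrMr ?normr_gt0// distrC => /le_lt_trans; apply.
by rewrite distrC mulrC -ltr_pdivlMr.
Qed.

(** The derivative is a pointwise limit of difference quotients of f, which is continuous and hence
    measurable. *)
Lemma measurable_derive01 (R : realType) (f d : R -> R) :
  (forall t, t \in `[0, 1] -> is_derive01 f t (d t)) ->
  measurable_fun (`[0, 1] : set R) d.
Proof.
move=> fd; have mf : measurable_fun (`[0, 1] : set R) f.
  apply: subspace_continuous_measurable_fun; first exact: measurable_itv.
  exact: derive01_continuous fd.
(* Forward quotients make sense only for t < 1, and a single point does not affect measurability. *)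
apply/measurable_fun_itv_bndo_bndcP.
(* Truncation at 1 keeps the second node in the domain. For fixed t < 1 it is eventually inactive,
   so that multiplying by n+1 divides by the actual step. *)
pose u n (t : R) : R := Num.min (t + n.+1%:R^-1) 1.
apply: (@measurable_fun_cvg _ _ _ _ (fun n t => (f (u n t) - f t) * n.+1%:R)).
  move=> n.
  have mu : measurable_fun (`[0, 1[ : set R) (u n).
    apply: measurable_minr => //; exact: measurable_funD.
  have mfu : measurable_fun (`[0, 1[ : set R) (f \o u n).
    apply: (measurable_comp _ _ mf mu); first exact: measurable_itv.
    move=> _ [t /=] + <-; rewrite !in_itv/= => /andP[t0 t1].
    by rewrite le_min ge_min lexx orbT ler01 !andbT addr_ge0.
  apply: measurable_funM => //.
  apply: measurable_funB => //.
  apply: measurable_funS mf => // t.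
  by rewrite /= !in_itv/= => /andP[-> /ltW->].
move=> t /=; rewrite in_itv/= => /andP[t0 t1].
have t01 : t \in `[0, 1] by rewrite in_itv/= t0 ltW.
apply/(@cvgrPdist_lt R R) => e e0.
have /is_derive01P/(_ e e0)[r r0 rP] := fd t t01.
near=> n.
have nr : n.+1%:R^-1 < r.
  by near: n; exact: (near_infty_natSinv_lt (PosNum r0)).
have n1 : n.+1%:R^-1 < 1 - t.
  by near: n; apply: (near_infty_natSinv_lt (PosNum _)); rewrite subr_gt0.
have -> : u n t = t + n.+1%:R^-1 by rewrite /u; apply/min_idPl; rewrite -lerBrDl ltW.
have n0 : 0 < n.+1%:R^-1 :> R by rewrite invr_gt0.
have := rP (t + n.+1%:R^-1).
rewrite [X in _ / X]addrAC subrr add0r invrK; apply.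
- rewrite in_itv/=; apply/andP; split; first by rewrite addr_ge0// ltW.
  by rewrite -lerBrDl ltW.
- by rewrite -subr_eq0 addrC addKr gt_eqF.
- by rewrite opprD addNKr normrN gtr0_norm.
Unshelve. all: end_near. Qed.

Lemma integral_is_derive (R : realType) (F f : R -> R) (a b : R) : a < b ->
  (forall t : R, t \in `[a, b] -> is_derive t (1 : R) F (f t)) ->
  (forall t : R, t \in `[a, b] -> {for t, continuous f}) ->
  (\int[mu]_(t in `[a, b]) (f t)%:E = (F b - F a)%:E)%E.
Proof.
move=> ab dF cf; have cF (t : R) : t \in `[a, b] -> {for t, continuous F}.
  by move=> /dF[/derivable1_diffP/differentiable_continuous].
have aab : a \in `[a, b] by rewrite in_itv/= lexx ltW.
have bab : b \in `[a, b] by rewrite in_itv/= lexx ltW.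
rewrite (continuous_FTC2 ab _ (F := F))//.
- by apply: continuous_in_subspaceT => t; rewrite inE => /cf.
- split=> [t tab||].
  + have [] // := dF t _; exact: subset_itv_oo_cc.
  + by apply: cvg_at_right_filter; exact: cF.
  + by apply: cvg_at_left_filter; exact: cF.
- move=> t tab; rewrite derive1E; have [] // := dF t _.
  exact: subset_itv_oo_cc.
Qed.

(** * Extremals and their cost *)

(** The Euler-Lagrange equation for the scalar problem with its first
    integral. *)
Definition extremal (R : realType) (sigma K : R) (p dp : R -> R) :=
  [/\ forall t : R, is_derive t (1 : R) p (dp t),
      forall t : R, is_derive t (1 : R) dp (K * p t),
      forall t : R, t \in `[0, 1] -> 0 < p t
    & forall t : R, K * p t ^+ 2 - dp t ^+ 2 = - sigma ^+ 4].

(** The constraint p' = 2 a p + sigma^2 solved for a. *)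
Definition ctrl (R : realType) (sigma : R) (p dp : R -> R) (t : R) :=
  (dp t - sigma ^+ 2) / (2 * p t).

(** An antiderivative of [ctrl ^+ 2] along an extremal. *)
Definition value (R : realType) (sigma K : R) (p dp : R -> R) (t : R) :=
  4^-1 * (K * t - 2 * (dp t / p t) + 2 * sigma ^+ 2 * (p t)^-1).

(** With u = ln p this is u'' = - s^2 e^-2u: the numerator p p'' - p'^2 of the derivative of p'/p is
    the first integral. *)
Lemma is_derive_logder (R : realType) (sigma K : R) (p dp : R -> R) (t : R) :
  extremal sigma K p dp -> t \in `[0, 1] ->
  is_derive t (1 : R) (dp * (fun t => (p t)^-1)) (- sigma ^+ 4 * (p t)^-1 ^+ 2).
Proof.
move=> [dpE ddpE p_gt0 pE] t01; have pt0 : p t != 0 by rewrite gt_eqF ?p_gt0.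
have dV := is_deriveV pt0 (dpE t).
have dpt := ddpE t.
apply: is_derive_eq; rewrite /GRing.scale/= -(pE t).
by field.
Qed.

Lemma feasible_ctrl (R : realType) (sigma K : R) (p dp : R -> R) :
  extremal sigma K p dp -> feasible sigma (p 0) (p 1) p (ctrl sigma p dp).
Proof.
move=> [dpE ddpE p_gt0 pE]; split => // t t01; apply: is_derive_derive01; rewrite /ctrl.
have -> : 2 * ((dp t - sigma ^+ 2) / (2 * p t)) * p t + sigma ^+ 2 = dp t.
  by field; rewrite gt_eqF ?p_gt0.
exact: dpE.
Qed.

Lemma cost_ctrl (R : realType) (sigma K : R) (p dp : R -> R) :
  extremal sigma K p dp ->
  cost p (ctrl sigma p dp)
  = (value sigma K p dp 1 - value sigma K p dp 0)%:E.
Proof.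
move=> ext; have [dpE ddpE p_gt0 pE] := ext.
rewrite (costE (feasible_ctrl ext)); pose s := sigma ^+ 2.
have pt0 (t : R) : t \in `[0, 1] -> p t != 0 by move=> t01; rewrite gt_eqF ?p_gt0.
have cc (t : R) : t \in `[0, 1] -> {for t, continuous (fun t => ctrl sigma p dp t ^+ 2)}.
  move=> t01.
  have dV := is_deriveV (pt0 _ t01) (dpE t).
  have -> : (fun t => ctrl sigma p dp t ^+ 2) =
      (2^-1 *: ((dp - cst s) * (fun t => (p t)^-1))) ^+ 2.
    by apply/funext => u; rewrite !fctE/= /GRing.scale/= /ctrl invfM mulrCA.
  have dpt := ddpE t.
  apply: differentiable_continuous; apply/derivable1_diffP.
  exact: ex_derive.
have dv (t : R) : t \in `[0, 1] ->
    is_derive t (1 : R) (value sigma K p dp) (ctrl sigma p dp t ^+ 2).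
  move=> t01.
  have dV := is_deriveV (pt0 _ t01) (dpE t).
  have dL := is_derive_logder ext t01.
  have dv : is_derive t (1 : R) (value sigma K p dp) _ :=
    is_deriveZ 4^-1 (is_deriveD (is_deriveB (is_deriveZ K (is_derive_id t (1 : R)))
      (is_deriveZ 2 dL)) (is_deriveZ (2 * sigma ^+ 2) dV)).
  apply: (is_derive_eq dv); rewrite /GRing.scale/= /ctrl.
  (* Eliminating K by the first integral leaves a rational identity in p and p', the square (p' -
     s)^2 / (4 p^2). *)
  have -> : K = (dp t ^+ 2 - sigma ^+ 4) / p t ^+ 2.
    by rewrite -(pE t); field; exact: pt0.
  by field; exact: pt0.
exact: (integral_is_derive ltr01 dv cc).
Qed.

(** * Lower bound for competitors and uniqueness *)

(** Here i = 1/q, j = 1/p, z = q'/q, y = p'/p and w = ln q - ln p, so that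
    w' = z - y; the slack is (w' - l)^2 plus a convexity gap. *)
Lemma ctrl_pointwise (R : realType) (s K z i j y w l : R) :
  0 < i -> 0 < j ->
  K = y ^+ 2 - s ^+ 2 * j ^+ 2 -> w = ln j - ln i ->
  4^-1 * (2 * (- s ^+ 2 * j ^+ 2 * w + y * (z - y)) - 2 * s * (z * i)
    + K + 2 * (s ^+ 2 * j ^+ 2) + 2 * l * (z - y) - l ^+ 2)
  <= ((z - s * i) / 2) ^+ 2.
Proof.
move=> i0 j0 KE wE.
(* Convexity of the exponential: e^x >= 1 + x at x = - 2 w, where e^(- 2 w) = i^2 / j^2. *)
have ij : j ^+ 2 * (1 - 2 * w) <= i ^+ 2.
  rewrite -ler_pdivlMl ?exprn_gt0//.
  apply: (le_trans (expR_ge1Dx _)); rewrite wE.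
  have -> : - (2 * (ln j - ln i)) = ln i + ln i - (ln j + ln j) by ring.
  rewrite expRD expRN !expRD !lnK ?posrE//.
  by rewrite mulrC !expr2.
have : 0 <= (z - y - l) ^+ 2 + s ^+ 2 * (i ^+ 2 - j ^+ 2 * (1 - 2 * w)).
  by rewrite addr_ge0 ?sqr_ge0// mulr_ge0 ?sqr_ge0// subr_ge0.
by rewrite KE -subr_ge0 => H; lra.
Qed.

(** Keeping (w')^2 >= 2 l w' - l^2 with l = 2 w(t0) before t0 and
    l = - 2 w(t0) after it gains w(t0)^2, which gives uniqueness. *)
Lemma cost_ge (R : realType) (sigma K : R) (p dp q c : R -> R) (t0 : R) :
  extremal sigma K p dp -> feasible sigma (p 0) (p 1) q c -> t0 \in `]0, 1[ ->
  ((value sigma K p dp 1 - value sigma K p dp 0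
    + (ln (q t0) - ln (p t0)) ^+ 2)%:E <= cost q c)%E.
Proof.
move=> ext feas t0oo; have [dpE ddpE p_gt0 pE] := ext.
have [q_gt0 dq q0 q1] := feas; rewrite (costE feas).
pose s := sigma ^+ 2; pose i t := (q t)^-1; pose j t := (p t)^-1.
pose y := dp * j; pose w := (@ln R \o q) - (@ln R \o p).
(* At l = 0, F is a calibration: F' <= c^2, and F - value vanishes at the
   endpoints. *)
pose F (l : R) := 4^-1 *: (2 *: (y * w) + (2 * s) *: i + K *: id - 2 *: y
  + (2 * l) *: w - l ^+ 2 *: id).
have pN0 (t : R) : t \in `[0, 1] -> p t != 0 by move=> /p_gt0 /gt_eqF ->.
have qN0 (t : R) : t \in `[0, 1] -> q t != 0 by move=> /q_gt0 /gt_eqF ->.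
have oo_cc (t : R) : t \in `]0, 1[ -> t \in `[0, 1] by exact: subset_itv_oo_cc.
(* By the differential equation this is q'/q. *)
pose z t := (2 * c t * q t + s) * i t.
have cE t : t \in `[0, 1] -> c t = (z t - s * i t) / 2.
  by move=> t01; rewrite /z /i; field; exact: qN0.
have dF l (t : R) : t \in `]0, 1[ -> is_derive t (1 : R) (F l)
    (4^-1 * (2 * (- s ^+ 2 * j t ^+ 2 * w t + y t * (z t - y t))
      - 2 * s * (z t * i t) + K + 2 * (s ^+ 2 * j t ^+ 2)
      + 2 * l * (z t - y t) - l ^+ 2)).
  move=> too; have t01 := oo_cc t too.
  have dqt := derive01_is_derive too (dq t t01).
  have di := is_deriveV (qN0 _ t01) dqt.
  have dy := is_derive_logder ext t01.
  have dlq := is_derive1_comp (is_derive1_ln (q_gt0 _ t01)) dqt.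
  have dlp := is_derive1_comp (is_derive1_ln (p_gt0 _ t01)) (dpE t).
  have dw : is_derive t (1 : R) w (z t - y t).
    apply: (is_derive_eq (is_deriveB dlq dlp)).
    rewrite /z /y /i /j !fctE mulrC; congr (_ - _).
    exact: mulrC.
  have dFl : is_derive t (1 : R) (F l) _ :=
    is_deriveZ 4^-1 (is_deriveB (is_deriveD (is_deriveB (is_deriveD (is_deriveD
      (is_deriveZ 2 (is_deriveM dy dw)) (is_deriveZ (2 * s) di))
      (is_deriveZ K (is_derive_id t (1 : R)))) (is_deriveZ 2 dy))
      (is_deriveZ (2 * l) dw)) (is_deriveZ (l ^+ 2) (is_derive_id t (1 : R)))).
  apply: (is_derive_eq dFl); rewrite /GRing.scale/= /y /z /i /j /s /w/=.
  by field; rewrite pN0// qN0.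
have cF l : {within `[0, 1], continuous (F l)}.
  have cq := derive01_continuous dq.
  have cj (t : R) : t \in `[0, 1] -> {for t, continuous j}.
    move=> t01; have dj := is_deriveV (pN0 _ t01) (dpE t).
    by apply: differentiable_continuous; apply/derivable1_diffP; exact: ex_derive.
  have cy (t : R) : t \in `[0, 1] -> {for t, continuous y}.
    move=> t01; have dy := is_derive_logder ext t01.
    by apply: differentiable_continuous; apply/derivable1_diffP; exact: ex_derive.
  apply/subspace_continuousP => t t01.
  have within_cvg (f : R -> R) : {for t, continuous f} ->
      f x @[x --> within (`[0, 1] : set R) (nbhs t)] --> f t.
    exact: cvg_within_filter.
  move/subspace_continuousP : cq => /(_ t t01) cq.
  have ci : i x @[x --> within (`[0, 1] : set R) (nbhs t)] --> i t.
    by apply: cvgV => //; exact: qN0.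
  have cw : w x @[x --> within (`[0, 1] : set R) (nbhs t)] --> w t.
    apply: cvgB.
      by apply: continuous_cvg => //; apply: continuous_ln; exact: q_gt0.
    apply: continuous_cvg; first by apply: continuous_ln; exact: p_gt0.
    apply: within_cvg; apply: differentiable_continuous.
    by apply/derivable1_diffP; exact: ex_derive.
  have cid := within_cvg id (fun=> id).
  have {}cy := within_cvg _ (cy t t01).
  apply: cvgZr; apply: cvgB; last exact: cvgZr.
  apply: cvgD; last exact: cvgZr.
  apply: cvgB; last exact: cvgZr.
  apply: cvgD; last exact: cvgZr.
  by apply: cvgD; apply: cvgZr => //; exact: cvgM.
have Fc l (t : R) : t \in `]0, 1[ ->
    4^-1 * (2 * (- s ^+ 2 * j t ^+ 2 * w t + y t * (z t - y t))
      - 2 * s * (z t * i t) + K + 2 * (s ^+ 2 * j t ^+ 2)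
      + 2 * l * (z t - y t) - l ^+ 2) <= c t ^+ 2.
  move=> /oo_cc t01; rewrite cE//; apply: ctrl_pointwise.
  - by rewrite invr_gt0 q_gt0.
  - by rewrite invr_gt0 p_gt0.
  - rewrite /y /s /j !fctE -exprM.
    have -> : K = (dp t ^+ 2 - sigma ^+ 4) / p t ^+ 2.
      by rewrite -(pE t); field; exact: pN0.
    by field; exact: pN0.
  - by rewrite /w /j /i !fctE/= !lnV ?posrE ?q_gt0 ?p_gt0//; ring.
(* The control is recovered as (q' - s) / (2 q), where q' is measurable as a derivative and q is
   continuous and nonzero. *)
have mc : measurable_fun (`[0, 1] : set R) c.
  have mi : measurable_fun (`[0, 1] : set R) i.
    apply: subspace_continuous_measurable_fun; first exact: measurable_itv.
    apply/subspace_continuousP => t t01; apply: cvgV; first exact: qN0.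
    by move/subspace_continuousP : (derive01_continuous dq); exact.
  have md := measurable_derive01 dq.
  apply: (@eq_measurable_fun _ _ _ _ _ (fun t =>
      2^-1 * ((2 * c t * q t + sigma ^+ 2 - s) * i t))).
    by move=> t; rewrite inE => t01; rewrite /i /s; field; exact: qN0.
  apply: measurable_funM => //; apply: measurable_funM => //.
  exact: measurable_funB.
have mc2 : measurable_fun (`[0, 1] : set R) (fun t => c t ^+ 2).
  exact: measurable_funX.
have [t0_gt0 t0_lt1] : 0 < t0 /\ t0 < 1.
  by move: t0oo; rewrite in_itv/= => /andP[].
have subl : `[0, t0] `<=` (`[0, 1] : set R).
  by move=> t /=; rewrite !in_itv/= => /andP[-> /le_trans->//]; exact: ltW.
have subr : `[t0, 1] `<=` (`[0, 1] : set R).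
  by move=> t /=; rewrite !in_itv/= => /andP[/(le_trans (ltW t0_gt0))-> ->].
pose d := w t0.
have le1 : ((F (2 * d) t0 - F (2 * d) 0)%:E
    <= \int[mu]_(t in `[0%R, t0]) (c t ^+ 2)%:E)%E.
  have sub (t : R) : t \in `]0, t0[ -> t \in `]0, 1[.
    by rewrite !in_itv/= => /andP[-> /lt_trans->].
  apply: (le_integral_derive t0_gt0 _ (fun t tt => dF (2 * d) t (sub t tt))).
  - apply: continuous_subspaceW (cF _); exact: subl.
  - apply: measurable_funS mc2 => //; exact: subl.
  - by move=> t _; exact: sqr_ge0.
  - by move=> t /sub; exact: Fc.
have le2 : ((F (- (2 * d)) 1 - F (- (2 * d)) t0)%:E
    <= \int[mu]_(t in `[t0, 1%R]) (c t ^+ 2)%:E)%E.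
  have sub (t : R) : t \in `]t0, 1[ -> t \in `]0, 1[.
    by rewrite !in_itv/= => /andP[/(lt_trans t0_gt0)-> ->].
  apply: (le_integral_derive t0_lt1 _ (fun t tt => dF (- (2 * d)) t (sub t tt))).
  - apply: continuous_subspaceW (cF _); exact: subr.
  - apply: measurable_funS mc2 => //; exact: subr.
  - by move=> t _; exact: sqr_ge0.
  - by move=> t /sub; exact: Fc.
have mcE : measurable_fun (`[0, 1] : set R) (fun t => (c t ^+ 2)%:E).
  exact/measurable_EFinP.
have -> : (\int[mu]_(t in `[0%R, 1%R]) (c t ^+ 2)%:E =
    \int[mu]_(t in `[0%R, t0]) (c t ^+ 2)%:E +
    \int[mu]_(t in `[t0, 1%R]) (c t ^+ 2)%:E)%E.
  rewrite -(integral_itv_obnd_cbnd (r := t0)); last first.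
    apply: measurable_funS mcE => //; apply: subset_trans subr.
    exact: subset_itv_oc_cc.
  have UE : `[0, 1]%classic = `[0, t0]%classic `|` `]t0, 1]%classic :> set R.
    by apply: itv_bndbnd_setU; rewrite bnd_simp ltW.
  rewrite UE ge0_integral_setU//.
  - by rewrite -UE.
  - by move=> t _; rewrite lee_fin sqr_ge0.
  - rewrite disj_set2E; apply/eqP; rewrite -subset0 => t [] /=.
    by rewrite !in_itv/= => /andP[_ tt0] /andP[]; rewrite ltNge tt0.
apply: le_trans (leeD le1 le2); rewrite -EFinD lee_fin.
have w0 : w 0 = 0 by rewrite /w !fctE/= q0 subrr.
have w1 : w 1 = 0 by rewrite /w !fctE/= q1 subrr.
rewrite /F !fctE/= w0 w1 /value /i /j q0 q1 -/(w t0) -/d.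
rewrite -[ln (q t0) - ln (p t0)]/d -[sigma ^+ 2]/s /GRing.scale/=.
have -> : y 0 = dp 0 / p 0 by [].
have -> : y 1 = dp 1 / p 1 by [].
(* Equality holds: [w] vanishes at both ends, the terms free of l cancel at [t0], and those in l
   contribute (8 d^2 - 4 d^2) / 4 = d^2. *)
rewrite le_eqVlt; apply/orP; left; apply/eqP.
lra.
Qed.

(** One interior point in [cost_ge] yields minimality. For a second minimizer, every interior t in
    turn forces the gap (ln q - ln p)^2 to vanish at t. *)
Lemma extremal_unique_solution (R : realType) (sigma K : R) (p dp : R -> R) :
  extremal sigma K p dp ->
  is_unique_solution sigma (p 0) (p 1) p (ctrl sigma p dp).
Proof.
move=> ext; have fp := feasible_ctrl ext.
have [dpE _ p_gt0 _] := ext; have optE := cost_ctrl ext.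
have half01 : (2^-1 : R) \in `]0, 1[.
  by rewrite in_itv/= invr_gt0 ltr0n/= invf_lt1// ltr1n.
split; [split => // q c fq|move=> q c [fq cost_min]].
  rewrite optE; apply: le_trans (cost_ge ext fq half01).
  by rewrite lee_fin lerDl sqr_ge0.
have [q_gt0 dq q0 q1] := fq.
have qp (t : R) : t \in `[0, 1] -> q t = p t.
  move=> t01; have [->//|t0] := eqVneq t 0; have [->//|t1] := eqVneq t 1.
  have too : t \in `]0, 1[.
    by move: t01; rewrite !in_itv/= !lt_neqAle t1 (eq_sym 0) t0.
  have := le_trans (cost_ge ext fq too) (cost_min _ _ fp).
  rewrite optE lee_fin gerDl => w2.
  have /eqP : (ln (q t) - ln (p t)) ^+ 2 = 0.
    by apply/eqP; rewrite eq_le w2 sqr_ge0.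
  rewrite sqrf_eq0 subr_eq0 => /eqP; apply: ln_inj; rewrite posrE.
    exact: q_gt0.
  exact: p_gt0.
move=> t t01; split; first exact: qp.
(* Equal paths have equal relative derivatives, and the differential equation then determines the
   control because p > 0. *)
have dqp : is_derive01 q t (dp t).
  have /is_derive01P dpt := is_derive_derive01 (dpE t).
  apply/is_derive01P => e /dpt[r r0 rP]; exists r => // u u01 ut ur.
  by rewrite !qp//; exact: rP.
have := is_derive01_unique t01 (dq t t01) dqp.
rewrite /ctrl qp// => <-; field.
by rewrite gt_eqF ?p_gt0.
Qed.

(** * The hyperbolic case *)

(** Since e^(bt) e^(-bt) = 1, the first integral b^2 p^2 - p'^2 is the constant 4 al be b^2, which
    explains the condition on the coefficients. *)
Lemma extremal_exp (R : realType) (sigma al be b : R) :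
  4 * (al * be) * b ^+ 2 = - sigma ^+ 4 ->
  (forall t : R, t \in `[0, 1] ->
    0 < al * expR (b * t) + be * expR (- (b * t))) ->
  extremal sigma (b ^+ 2)
    (fun t => al * expR (b * t) + be * expR (- (b * t)))
    (fun t => b * (al * expR (b * t) - be * expR (- (b * t)))).
Proof.
move=> albe p_gt0.
have dL (t : R) := is_deriveZ b (is_derive_id t (1 : R)).
have dE (t : R) := @is_derive1_comp R expR ( *%R b) t _ _
  (is_derive_expR (b * t)) (dL t).
have dEN (t : R) := @is_derive1_comp R expR (fun t => - (b * t)) t _ _
  (is_derive_expR (- (b * t))) (is_deriveN (dL t)).
split=> // t.
- have dp : is_derive t (1 : R)
      (fun t => al * expR (b * t) + be * expR (- (b * t))) _ :=
    is_deriveD (is_deriveZ al (dE t)) (is_deriveZ be (dEN t)).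
  by apply: (is_derive_eq dp); rewrite /GRing.scale/=; ring.
- have dp : is_derive t (1 : R)
      (fun t => b * (al * expR (b * t) - be * expR (- (b * t)))) _ :=
    is_deriveZ b (is_deriveB (is_deriveZ al (dE t)) (is_deriveZ be (dEN t))).
  by apply: (is_derive_eq dp); rewrite /GRing.scale/=; ring.
- rewrite -albe.
  suff : expR (b * t) * expR (- (b * t)) = 1.
    move: (expR (b * t)) (expR (- (b * t))) => E E' EE'.
    have -> : 4 * (al * be) * b ^+ 2 = 4 * (al * be) * b ^+ 2 * (E * E').
      by rewrite EE' mulr1.
    by ring.
  by rewrite -expRD subrr expR0.
Qed.

(** The condition on b under which the combination of [expR (b * t)] and
    [expR (- (b * t))] through the two endpoints is extremal. *)
Lemma exists_exp_rate (R : realType) (p0 p1 s : R) :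
  0 < p0 -> 0 < p1 -> 0 < s -> s < `|p1 - p0| ->
  exists2 b, 0 < b & b ^+ 2 * (p0 ^+ 2 + p1 ^+ 2 - p0 * p1 * (expR b + expR (- b)))
    = s ^+ 2 / 4 * (expR b - expR (- b)) ^+ 2.
Proof.
move=> p0_gt0 p1_gt0 s_gt0 sp.
have cexp (x : R) := @continuous_expR R x.
have cexpN : continuous (fun x : R => expR (- x)).
  by move=> x; apply: continuous_comp; [exact: opp_continuous|exact: continuous_expR].
(* f x >= x^2 g x because sinh x <= x e^x. *)
pose g (x : R) := p0 ^+ 2 + p1 ^+ 2 - p0 * p1 * (expR x + expR (- x))
  - s ^+ 2 * (expR x * expR x).
pose f (x : R) := x * x * (p0 ^+ 2 + p1 ^+ 2 - p0 * p1 * (expR x + expR (- x)))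
  - s ^+ 2 / 4 * ((expR x - expR (- x)) * (expR x - expR (- x))).
have ch : continuous (fun x : R => p0 ^+ 2 + p1 ^+ 2 - p0 * p1 * (expR x + expR (- x))).
  move=> x; apply: cvgB; first exact: cvg_cst.
  by apply: cvgMr; apply: cvgD; [exact: cexp|exact: cexpN].
have cg : continuous g.
  move=> x; apply: cvgB; first exact: ch.
  by apply: cvgMr; apply: cvgM; exact: cexp.
have cf : continuous f.
  move=> x; apply: cvgB.
    by apply: cvgM; [apply: cvgM; exact: cvg_id|exact: ch].
  apply: cvgMr; apply: cvgM.
    by apply: cvgB; [exact: cexp|exact: cexpN].
  by apply: cvgB; [exact: cexp|exact: cexpN].
have g0 : 0 < g 0.
  rewrite /g oppr0 expR0.
  have : 0 < `|p1 - p0| ^+ 2 - s ^+ 2.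
    by rewrite subr_gt0 ltr_pXn2r// ?nnegrE// ltW.
  by rewrite real_normK ?num_real//; lra.
(* At this point e^B > B makes the bracket in [f] negative. *)
pose B := (p0 ^+ 2 + p1 ^+ 2) / (p0 * p1).
have p01 : 0 < p0 * p1 by exact: mulr_gt0.
have B_gt0 : 0 < B by rewrite divr_gt0// addr_gt0// exprn_gt0.
(* [f] vanishes at 0 and gives no sign there; [g] does, as [g 0] is (p1 - p0)^2 - s^2 > 0. *)
have [b [b0 bB gb]] : exists b, [/\ 0 < b, b <= B & 0 < g b].
  near (0 : R)^'+ => b; exists b; split.
  - by near: b; exact: nbhs_right_gt.
  - by near: b; exact: nbhs_right_le.
  - by near: b; apply: (cvgr_gt (g 0)) => //; apply: cvg_at_right_filter; exact: cg.
have fb : 0 < f b.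
  have sh : expR b - expR (- b) <= 2 * b * expR b.
    have := expR_ge1Dx (- b - b); rewrite expRD => h.
    have EN : expR (- b) * expR b = 1 by rewrite -expRD addNr expR0.
    have : (1 + (- b - b)) * expR b <= expR (- b) * expR (- b) * expR b.
      by rewrite ler_pM2r// expR_gt0.
    by rewrite -mulrA EN mulr1 => {}h; lra.
  have sh0 : 0 <= expR b - expR (- b) by rewrite subr_ge0 ler_expR; lra.
  have sh2 : (expR b - expR (- b)) * (expR b - expR (- b))
      <= (2 * b * expR b) * (2 * b * expR b) by exact: ler_pM.
  have : 0 < b * b * g b by rewrite !mulr_gt0.
  have : s ^+ 2 / 4 * ((expR b - expR (- b)) * (expR b - expR (- b)))
      <= s ^+ 2 / 4 * ((2 * b * expR b) * (2 * b * expR b)).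
    by rewrite ler_pM2l// divr_gt0// exprn_gt0.
  by rewrite /f /g => ? ?; lra.
have fB : f B <= 0.
  rewrite subr_le0; apply: (@le_trans _ _ 0); last first.
    by rewrite mulr_ge0 ?divr_ge0 ?sqr_ge0// -expr2 sqr_ge0.
  apply: mulr_ge0_le0; first by rewrite mulr_ge0// ltW.
  rewrite subr_le0.
  rewrite -ler_pdivrMl// mulrC -/B.
  have := expR_ge1Dx B; have := expR_gt0 (- B); lra.
have [||x] := @IVT _ f b B 0 bB.
- by apply: continuous_subspaceT.
- by rewrite ge_min fB orbT/= le_max ltW.
rewrite in_itv/= => /andP[bx _] /eqP; rewrite subr_eq0 => /eqP fx.
by exists x; [exact: lt_le_trans bx|rewrite !expr2 fx].
Unshelve. all: by end_near.
Qed.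

Lemma hyperbolic_case (R : realType) (p0 p1 sigma : R) :
  0 < p0 -> 0 < p1 -> 0 < sigma -> sigma ^+ 2 < `|p1 - p0| ->
  exists p a : R -> R,
    is_unique_solution sigma p0 p1 p a /\
    exists alpha b : R,
      [/\ alpha != 0, b != 0
        & forall t : R, t \in `[0, 1] ->
            p t = alpha * expR (b * t)
                  - sigma ^+ 4 / (4 * alpha * b ^+ 2) * expR (- (b * t))].
Proof.
move=> p0_gt0 p1_gt0 sigma_gt0 sp.
have [b b0 bE] := exists_exp_rate p0_gt0 p1_gt0 (exprn_gt0 2 sigma_gt0) sp.
have bN0 : b != 0 by rewrite gt_eqF.
pose E := expR b; pose E' := expR (- b).
have EE' : E * E' = 1 by rewrite -expRD subrr expR0.
have sh0 : 0 < E - E' by rewrite subr_gt0 ltr_expR; lra.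
have shN0 : E - E' != 0 by rewrite gt_eqF.
(* Solution of the linear system p(0) = p0, p(1) = p1. *)
pose al := (p1 - p0 * E') / (E - E'); pose be := (p0 * E - p1) / (E - E').
have albe : 4 * (al * be) * b ^+ 2 = - sigma ^+ 4.
  have -> : sigma ^+ 4 = b ^+ 2 * (p0 ^+ 2 + p1 ^+ 2 - p0 * p1 * (E + E'))
      * 4 / (E - E') ^+ 2.
    by rewrite bE -/E -/E'; field.
  rewrite /al /be.
  (* Inserting E E' = 1 makes both sides agree as rational functions of E and E'. *)
  have -> : p0 ^+ 2 = p0 ^+ 2 * (E * E') by rewrite EE' mulr1.
  by field.
have albeN0 : al * be != 0.
  apply/eqP => ab0; have := albe; rewrite ab0 mulr0 mul0r => /eqP.
  by rewrite eq_sym oppr_eq0 expf_eq0/= gt_eqF.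
have alN0 : al != 0 by apply: contraNneq albeN0 => ->; rewrite mul0r.
pose p (t : R) := al * expR (b * t) + be * expR (- (b * t)).
have p_0 : p 0 = p0.
  by rewrite /p mulr0 oppr0 expR0 /al /be; field.
have p_1 : p 1 = p1.
  rewrite /p mulr1 -/E -/E' /al /be.
  have -> : (p1 - p0 * E') / (E - E') * E + (p0 * E - p1) / (E - E') * E' = p1.
    by field.
  by [].
have p_gt0 (t : R) : t \in `[0, 1] -> 0 < p t.
  rewrite in_itv/= => /andP[t0 t1].
  (* p t = (p0 sinh (b (1 - t)) + p1 sinh (b t)) / sinh b *)
  have -> : p t = (p0 * (expR (b * (1 - t)) - expR (- (b * (1 - t))))
     + p1 * (expR (b * t) - expR (- (b * t)))) / (E - E').
    have -> : b * (1 - t) = b - b * t by rewrite mulrBr mulr1.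
    rewrite opprB !expRD -/E -/E' /p /al /be.
    by field.
  rewrite divr_gt0//.
  have pos x : 0 <= x -> 0 <= expR (b * x) - expR (- (b * x)).
    move=> x0; have bx : 0 <= b * x by rewrite mulr_ge0// ltW.
    by rewrite subr_ge0 ler_expR; lra.
  have spos x : 0 < x -> 0 < expR (b * x) - expR (- (b * x)).
    move=> x0; have bx : 0 < b * x by rewrite mulr_gt0.
    by rewrite subr_gt0 ltr_expR; lra.
  have [->|tN0] := eqVneq t 0.
    by rewrite subr0 ltr_pwDl ?mulr_gt0 ?spos// mulr_ge0 ?pos// ltW.
  rewrite ltr_wpDl ?mulr_gt0 ?spos//; last by rewrite lt_neqAle eq_sym tN0.
  by rewrite mulr_ge0 ?pos ?subr_ge0// ltW.
exists p, (ctrl sigma p (fun t => b * (al * expR (b * t) - be * expR (- (b * t))))).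
split.
  rewrite -[X in is_unique_solution _ X _]p_0 -[X in is_unique_solution _ _ X]p_1.
  by apply: extremal_unique_solution; exact: extremal_exp.
exists al, b; split => // t _.
(* By [albe], the coefficient [be] is - sigma^4 / (4 al b^2). *)
have -> : sigma ^+ 4 = - (4 * (al * be) * b ^+ 2) by rewrite albe opprK.
by rewrite /p; field; rewrite alN0 bN0.
Qed.

(** * The trigonometric case *)

Lemma extremal_trig (R : realType) (sigma A B w : R) :
  w ^+ 2 * (A ^+ 2 + B ^+ 2) = sigma ^+ 4 ->
  (forall t : R, t \in `[0, 1] -> 0 < A * cos (w * t) + B * sin (w * t)) ->
  extremal sigma (- w ^+ 2)
    (fun t => A * cos (w * t) + B * sin (w * t))
    (fun t => w * (B * cos (w * t) - A * sin (w * t))).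
Proof.
move=> AB p_gt0.
have dL (t : R) := is_deriveZ w (is_derive_id t (1 : R)).
have dC (t : R) := @is_derive1_comp R cos ( *%R w) t _ _
  (is_derive_cos (w * t)) (dL t).
have dS (t : R) := @is_derive1_comp R sin ( *%R w) t _ _
  (is_derive_sin (w * t)) (dL t).
split=> // t.
- have dp : is_derive t (1 : R) (fun t => A * cos (w * t) + B * sin (w * t)) _ :=
    is_deriveD (is_deriveZ A (dC t)) (is_deriveZ B (dS t)).
  by apply: (is_derive_eq dp); rewrite /GRing.scale/=; ring.
- have dp : is_derive t (1 : R)
      (fun t => w * (B * cos (w * t) - A * sin (w * t))) _ :=
    is_deriveZ w (is_deriveB (is_deriveZ B (dC t)) (is_deriveZ A (dS t))).
  by apply: (is_derive_eq dp); rewrite /GRing.scale/=; ring.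
- rewrite -AB; have := cos2Dsin2 (w * t).
  move: (cos (w * t)) (sin (w * t)) => C S CS.
  have -> : w ^+ 2 * (A ^+ 2 + B ^+ 2)
      = w ^+ 2 * (A ^+ 2 + B ^+ 2) * (C ^+ 2 + S ^+ 2) by rewrite CS mulr1.
  by ring.
Qed.

(** The equation says w^2 (p0^2 + B^2) = s^2 for the B with p0 cos w + B sin w = p1, which is the
    first integral of the path joining the endpoints. *)
Lemma exists_trig_rate (R : realType) (p0 p1 s : R) :
  0 < p0 -> 0 < p1 -> 0 < s -> `|p1 - p0| < s ->
  exists2 w, 0 < w < pi & w ^+ 2 * (p0 ^+ 2 + p1 ^+ 2 - 2 * p0 * p1 * cos w)
    = s ^+ 2 * sin w ^+ 2.
Proof.
move=> p0_gt0 p1_gt0 s_gt0 sp.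
have ccos (x : R) := @continuous_cos R x.
have csin (x : R) := @continuous_sin R x.
pose h (x : R) := p0 ^+ 2 + p1 ^+ 2 - 2 * p0 * p1 * cos x.
pose f (x : R) := x * x * h x - s ^+ 2 * (sin x * sin x).
(* For x > 0, f x = x^2 g x. As sin x / x tends to 1, [g] tends to (p1 - p0)^2 - s^2 < 0, which
   gives [f] a sign near 0. *)
pose g (x : R) := h x - s ^+ 2 * ((x^-1 * sin x) * (x^-1 * sin x)).
have ch : continuous h.
  by move=> x; apply: cvgB; [exact: cvg_cst|apply: cvgMr; exact: ccos].
have cf : continuous f.
  move=> x; apply: cvgB.
    by apply: cvgM; [apply: cvgM; exact: cvg_id|exact: ch].
  by apply: cvgMr; apply: cvgM; exact: csin.
have sinc : (x^-1 * sin x) @[x --> (0 : R)^'+] --> (1 : R).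
  have [ds dsE] := is_derive_sin (0 : R).
  have : (x^-1 *: (sin (x *: 1 + 0) - sin 0)) @[x --> (0 : R)^']
      --> 'D_1 (@sin R) 0 by exact: ds.
  rewrite dsE cos0.
  have -> : (fun x : R => x^-1 *: (sin (x *: 1 + 0) - sin 0)) = (fun x => x^-1 * sin x).
    by apply/funext => x; rewrite /GRing.scale/= mulr1 addr0 sin0 subr0.
  exact: cvg_dnbhs_at_right.
have cg : g x @[x --> (0 : R)^'+] --> h 0 - s ^+ 2 * (1 * 1).
  apply: cvgB; first by apply: cvg_at_right_filter; exact: ch.
  by apply: cvgMr; apply: cvgM.
have g0 : h 0 - s ^+ 2 * (1 * 1) < 0.
  rewrite /h cos0.
  have : 0 < s ^+ 2 - `|p1 - p0| ^+ 2.
    by rewrite subr_gt0 ltr_pXn2r// ?nnegrE// ltW.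
  by rewrite real_normK ?num_real//; lra.
have pi0 := pi_gt0 R.
have [b [b0 bB gb]] : exists b, [/\ 0 < b, b <= pi & g b < 0].
  near (0 : R)^'+ => b; exists b; split.
  - by near: b; exact: nbhs_right_gt.
  - by near: b; exact: nbhs_right_le.
  - by near: b; exact: (cvgr_lt _ cg).
have fb : f b < 0.
  have -> : f b = b * b * g b by rewrite /f /g; field; rewrite gt_eqF.
  by rewrite nmulr_llt0// mulr_gt0.
(* The value is pi^2 (p0 + p1)^2; its strict positivity also keeps the root below pi. *)
have fpi : 0 < f pi.
  rewrite /f sinpi mulr0 mulr0 subr0 !mulr_gt0// /h cospi.
  have -> : p0 ^+ 2 + p1 ^+ 2 - 2 * p0 * p1 * -1 = (p0 + p1) ^+ 2 by ring.
  by rewrite exprn_gt0// addr_gt0.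
have [||x] := @IVT _ f b pi 0 bB.
- by apply: continuous_subspaceT.
- by rewrite ge_min (ltW fb)/= le_max (ltW fpi) orbT.
rewrite in_itv/= => /andP[bx xpi] fx0.
exists x; last by move/eqP: fx0; rewrite subr_eq0 => /eqP fx; rewrite !expr2 -fx.
rewrite (lt_le_trans b0 bx)/= lt_neqAle xpi andbT.
by apply: contraTneq fpi => <-; rewrite fx0 ltxx.
Unshelve. all: by end_near.
Qed.

Lemma trigonometric_case (R : realType) (p0 p1 sigma : R) :
  0 < p0 -> 0 < p1 -> 0 < sigma -> `|p1 - p0| < sigma ^+ 2 ->
  exists p a : R -> R,
    is_unique_solution sigma p0 p1 p a /\
    exists omega theta : R,
      [/\ 0 < omega < pi, - (pi / 2) < theta < pi / 2
        & forall t : R, t \in `[0, 1] ->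
            p t = sigma ^+ 2 / omega * cos (omega * t + theta)].
Proof.
move=> p0_gt0 p1_gt0 sigma_gt0 sp.
have s_gt0 : 0 < sigma ^+ 2 by exact: exprn_gt0.
have [w /andP[w0 wpi] wE] := exists_trig_rate p0_gt0 p1_gt0 s_gt0 sp.
have sw0 : 0 < sin w by apply: sin_gt0_pi; rewrite w0.
have swN0 : sin w != 0 by rewrite gt_eqF.
have wN0 : w != 0 by rewrite gt_eqF.
have sN0 : sigma != 0 by rewrite gt_eqF.
pose B := (p1 - p0 * cos w) / sin w.
have pB : w ^+ 2 * (p0 ^+ 2 + B ^+ 2) = sigma ^+ 4.
  have -> : sigma ^+ 4 = w ^+ 2 * (p0 ^+ 2 + p1 ^+ 2 - 2 * p0 * p1 * cos w)
      / sin w ^+ 2.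
    by rewrite wE; field.
  have -> : p0 ^+ 2 + p1 ^+ 2 - 2 * p0 * p1 * cos w
      = p0 ^+ 2 * (cos w ^+ 2 + sin w ^+ 2) + p1 ^+ 2 - 2 * p0 * p1 * cos w.
    by rewrite cos2Dsin2 mulr1.
  by rewrite /B; field.
pose p (t : R) := p0 * cos (w * t) + B * sin (w * t).
have p_0 : p 0 = p0 by rewrite /p mulr0 cos0 sin0 mulr0 mulr1 addr0.
have p_1 : p 1 = p1 by rewrite /p mulr1 /B; field.
have p_gt0 (t : R) : t \in `[0, 1] -> 0 < p t.
  rewrite in_itv/= => /andP[t0 t1].
  (* Interpolation between the endpoints with sine weights, which are nonnegative because w < pi. *)
  have -> : p t = (p0 * sin (w * (1 - t)) + p1 * sin (w * t)) / sin w.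
    by rewrite mulrBr mulr1 sinB /p /B; field.
  rewrite divr_gt0//.
  have spos (x : R) : 0 < x -> x <= 1 -> 0 < sin (w * x).
    move=> x0 x1; apply: sin_gt0_pi; rewrite mulr_gt0//=.
    by apply: le_lt_trans wpi; rewrite ger_pMr.
  have pos (x : R) : 0 <= x -> x <= 1 -> 0 <= sin (w * x).
    rewrite le_eqVlt => /predU1P[<- _|x0 x1]; first by rewrite mulr0 sin0.
    by rewrite ltW// spos.
  have [->|tN0] := eqVneq t 0.
    by rewrite subr0 mulr0 sin0 mulr0 addr0 mulr_gt0// spos.
  rewrite ltr_wpDl//.
    by rewrite mulr_ge0 ?(ltW p0_gt0)// pos; lra.
  by rewrite mulr_gt0// spos// lt_neqAle eq_sym tN0.
exists p, (ctrl sigma p (fun t => w * (B * cos (w * t) - p0 * sin (w * t)))).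
split.
  rewrite -[X in is_unique_solution _ X _]p_0 -[X in is_unique_solution _ _ X]p_1.
  by apply: extremal_unique_solution; exact: extremal_trig.
(* Expanding cos (w t + theta) and matching coefficients gives sin theta = x and cos theta = y. As y
   > 0, theta = [asin x] has the right cosine and lies strictly between - pi/2 and pi/2. *)
pose x := - (w * B / sigma ^+ 2); pose y := w * p0 / sigma ^+ 2.
have y0 : 0 < y by rewrite divr_gt0 ?mulr_gt0.
have xy : 1 - x ^+ 2 = y ^+ 2.
  apply/eqP; rewrite subr_eq; apply/eqP.
  have -> : y ^+ 2 + x ^+ 2 = w ^+ 2 * (p0 ^+ 2 + B ^+ 2) / sigma ^+ 4.
    by rewrite /x /y; field.
  by rewrite pB divff// expf_neq0.
have x1 : -1 < x < 1.
  rewrite -ltr_norml -sqrtr_sqr -[ltRHS]sqrtr1 ltr_sqrt//.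
  by rewrite -subr_gt0 xy exprn_gt0.
have [x1l x1r] := andP x1.
exists w, (asin x); split; first by rewrite w0.
  by rewrite asin_gtNpi2 ?asin_ltpi2 ?x1l ?x1r// ?(ltW x1l) ?(ltW x1r).
move=> t _; rewrite cosD asinK; last by rewrite in_itv/= !ltW.
rewrite cos_asin ?xy; last by rewrite !ltW.
by rewrite sqrtr_sqr gtr0_norm// /p /x /y; field; rewrite sN0.
Qed.

Theorem proposition3 (R : realType) (p0 p1 sigma : R)
    (p0_gt0 : 0 < p0) (p1_gt0 : 0 < p1) (sigma_gt0 : 0 < sigma) :
  (sigma ^+ 2 < `|p1 - p0| ->
    exists p a : R -> R,
      is_unique_solution sigma p0 p1 p a /\
      exists alpha b : R,
        [/\ alpha != 0, b != 0
          & forall t : R, t \in `[0, 1] ->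
              p t = alpha * expR (b * t)
                    - sigma ^+ 4 / (4 * alpha * b ^+ 2) * expR (- (b * t))])
  /\
  (`|p1 - p0| < sigma ^+ 2 ->
    exists p a : R -> R,
      is_unique_solution sigma p0 p1 p a /\
      exists omega theta : R,
        [/\ 0 < omega < pi, - (pi / 2) < theta < pi / 2
          & forall t : R, t \in `[0, 1] ->
              p t = sigma ^+ 2 / omega * cos (omega * t + theta)]).
Proof.
split=> ?; [exact: hyperbolic_case|exact: trigonometric_case].
Qed.
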